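(* Let $K$ be a field, $S=K[x_1,\ldots,x_n]$, and let $I=I_{d;a_1,\ldots,a_n}\subset S$ be an ideal of Veronese type satisfying $$d<\sum_{i=1}^n a_i,\qquad d>1,\qquad a_1,\ldots,a_n\geq1.$$ Let $A$ be a subset of $\{1,\ldots,n\}$ with $P_A\in\operatorname{Ass}^{\infty}(I)$. Then the index of stability of $P_A$ is equal to $$\left\lceil\frac{|A|-1}{\sum_{i=1}^n a_i-d}\right\rceil.$$ In particular, $$\operatorname{astab}(I)=\left\lceil\frac{n-1}{\sum_{i=1}^n a_i-d}\right\rceil,$$ and $\operatorname{astab}(I)\leq n-1$.
   Context: For a positive integer $d$ and non-negative integers $a_1,\ldots,a_n$ with $a_1+\cdots+a_n\ge d$, the ideal of Veronese type $I_{d;a_1,\ldots,a_n}\subset S$ is the monomial ideal generated by all monomials $x_1^{u(1)}\cdots x_n^{u(n)}$ with $u(1)+\cdots+u(n)=d$ and $0\le u(i)\le a_i$ for all $i$. For a non-empty subset $A$ of $\{1,\ldots,n\}$, $P_A$ denotes the monomial prime ideal generated by the $x_i$ with $i\in A$. $\operatorname{Ass}(J)$ denotes the set of associated prime ideals of $S/J$, and $\operatorname{Ass}^\infty(I)$ is the stable value of $\operatorname{Ass}(I^k)$ for $k\gg0$ (which exists by a theorem of Brodmann). $\operatorname{astab}(I)$, the index of stability of $I$, is the smallest integer $k_1$ such that $\operatorname{Ass}(I^k)=\operatorname{Ass}(I^{k_1})$ for all $k\ge k_1$. For a prime $P\in\operatorname{Ass}^\infty(I)$, the index of stability of $P$ is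 the smallest integer $k$ such that $P\in\operatorname{Ass}(I^k)$.
   Formalization: The formula for the index of P_A is stated for |A| > 1, and the formula and bound for astab(I) for n > 1; for |A| = 1 (resp. n = 1) the printed formula gives 0, which is false (e.g. I = (x^2, xy), P_A = (x)), and the true value 1 is stated instead. *)

(* Defs.v *)
From HB Require Import structures.
From mathcomp Require Import all_boot all_order all_algebra.
From mathcomp Require Import ring_quotient.
From mathcomp Require Import mpoly.
From mathcomp Require Import boolp classical_sets.

Set Implicit Arguments.
Unset Strict Implicit.
Unset Printing Implicit Defensive.

Import Order.TTheory GRing.Theory Num.Theory.

Local Open Scope ring_scope.
Local Open Scope classical_set_scope.

(* The ideals of ring_quotient (idealr_closed) are proper; here the unit ideal
   is allowed. *)
Definition ideal (R : comNzRingType) (J : set R) : Prop :=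
  J 0 /\ forall a u v : R, J u -> J v -> J (a * u + v).

Definition ideal_gen (R : comNzRingType) (G : set R) : set R :=
  smallest (@ideal R) G.

Definition ideal_mul (R : comNzRingType) (J L : set R) : set R :=
  ideal_gen [set x | exists u v : R, [/\ J u, L v & x = u * v]].

Definition ideal_pow (R : comNzRingType) (J : set R) (k : nat) : set R :=
  iter k (ideal_mul J) [set: R].

(* idealr_closed includes 1 \notin P, so P is a proper ideal. *)
Definition prime_ideal (R : comNzRingType) (P : set R) : Prop :=
  idealr_closed (mem P) /\ prime_idealr_closed (mem P).

(* Associated primes of R / J: the annihilator of the class of f in R / J is
   J : f = {g | g f \in J}. *)
Definition Ass (R : comNzRingType) (J : set R) : set (set R) :=
  [set P | prime_ideal P /\ exists f : R, P = [set g | J (g * f)]].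

Definition Ass_stable_from (R : comNzRingType) (J : set R) (k1 : nat) : Prop :=
  (0 < k1)%N /\
  forall k : nat, (k1 <= k)%N -> Ass (ideal_pow J k) = Ass (ideal_pow J k1).

Definition Ass_infty (R : comNzRingType) (J : set R) : set (set R) :=
  [set P | exists2 k1 : nat, Ass_stable_from J k1 & Ass (ideal_pow J k1) P].

(* Junk value 0 when E is empty. The two indices below are minima of sets of
   positive integers, so they are 0 only if no such integer exists. *)
Definition least (E : set nat) : nat :=
  xget 0%N [set k | E k /\ forall j : nat, E j -> (k <= j)%N].

Definition astab (R : comNzRingType) (J : set R) : nat :=
  least [set k1 | Ass_stable_from J k1].

Definition prime_astab (R : comNzRingType) (J P : set R) : nat :=
  least [set k | (0 < k)%N /\ Ass (ideal_pow J k) P].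

Definition veronese (K : fieldType) (n d : nat) (a : 'I_n -> nat) :
    set {mpoly K[n]} :=
  ideal_gen [set x | exists u : 'X_{1..n},
    [/\ mdeg u = d, forall i : 'I_n, (u i <= a i)%N & x = 'X_[u]]].

Definition monomial_prime (K : fieldType) (n : nat) (A : {set 'I_n}) :
    set {mpoly K[n]} :=
  ideal_gen [set x | exists2 i : 'I_n, i \in A & x = 'X_i].

Arguments veronese K {n} d a.
Arguments monomial_prime K {n} A.

(* Main.v *)
Require Import Defs.
From mathcomp Require Import all_boot all_order all_algebra.
From mathcomp Require Import mpoly.
From mathcomp Require Import boolp classical_sets.
From mathcomp Require Import zify.
Import Order.TTheory GRing.Theory Num.Theory.
Local Open Scope ring_scope.

(* Powers of an ideal of Veronese type are again of Veronese type:
   I^k = I_{kd; k a_1, ..., k a_n}. Associated primes of a monomial ideal are the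
   P_A = (J : x^u) with x^u a monomial. If (I^k : x^u) = P_A, then, truncating u
   at k a, u has degree k d - 1, u_i < k a_i for i in A, and u_i may be raised to
   k a_i for i outside A. Such a u exists iff sum_{i notin A} a_i < d and
   |A| - 1 <= k (sum_i a_i - d). The first condition does not involve k, so the
   smallest k satisfying the second one is the index of stability of P_A, and
   the worst case is A = {1, ..., n}. *)

(** * Ideals and primes of a commutative ring *)

Lemma idealM {R : comNzRingType} {J : set R} (a u : R) :
  ideal J -> J u -> J (a * u).
Proof. by move=> [J0 JD] Ju; rewrite -[_ * _]addr0; apply: JD. Qed.

Lemma idealD {R : comNzRingType} {J : set R} {u v : R} :
  ideal J -> J u -> J v -> J (u + v).
Proof. by move=> [_ JD] Ju Jv; rewrite -[u]mul1r; apply: JD. Qed.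

Lemma idealB {R : comNzRingType} {J : set R} {u v : R} :
  ideal J -> J u -> J v -> J (u - v).
Proof.
by move=> idJ Ju Jv; apply: idealD => //; rewrite -mulN1r; apply: idealM.
Qed.

Lemma ideal_gen_ideal {R : comNzRingType} (G : set R) : ideal (ideal_gen G).
Proof.
split=> [J [[] //]|a u v Gu Gv J JG].
by have [[_ JD] _] := JG; apply: JD; [apply: Gu | apply: Gv].
Qed.

Lemma prime_ideal_ideal {R : comNzRingType} {P : set R} :
  prime_ideal P -> ideal P.
Proof.
move=> [[P0 _ PD] _]; split; first exact: set_mem P0.
by move=> a u v Pu Pv; apply/set_mem/PD; apply: mem_set.
Qed.

Lemma prime_idealM {R : comNzRingType} {P : set R} (u v : R) :
  prime_ideal P -> P (u * v) -> P u \/ P v.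
Proof. by move=> [_ pP] /mem_set/pP/orP[] /set_mem; [left|right]. Qed.

Lemma prime_ideal1 {R : comNzRingType} {P : set R} : prime_ideal P -> ~ P 1.
Proof. by move=> [[_ nP1 _] _] /mem_set; apply/negP. Qed.

(** * Monomial ideals *)

Definition upclosed {n} (M : pred 'X_{1..n}) :=
  forall g m, M m -> M (g + m)%MM.

(** A monomial ideal, encoded by its exponents so that membership is read off the support term by
    term; it is an ideal as soon as [M] is [upclosed]. *)
Definition mon_ideal (K : fieldType) {n} (M : pred 'X_{1..n}) :
  set {mpoly K[n]} := [set f | forall m, m \in msupp f -> M m].

Lemma mon_idealX (K : fieldType) {n} (M : pred 'X_{1..n}) m :
  mon_ideal K M 'X_[m] <-> M m.
Proof.
split=> [|Mm k]; first by apply; rewrite msuppX mem_head.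
by rewrite msuppX mem_seq1 => /eqP->.
Qed.

Lemma mon_ideal_ideal (K : fieldType) {n} {M : pred 'X_{1..n}} :
  upclosed M -> ideal (mon_ideal K M).
Proof.
move=> upM; split=> [m|a u v Mu Mv m /msuppD_le]; first by rewrite msupp0.
rewrite mem_cat => /orP[/msuppM_le/allpairsP[[g k] /= [_ ku ->]]|]; last exact: Mv.
exact/upM/Mu.
Qed.

Lemma mon_ideal_sub {K : fieldType} {n} {M : pred 'X_{1..n}}
    {J : set {mpoly K[n]}} :
  ideal J -> (forall m, M m -> J 'X_[m]) -> (mon_ideal K M `<=` J)%classic.
Proof.
move=> idJ MJ f Mf; rewrite [f]mpolyE big_seq.
apply: (big_ind J) => [|u v|m mf]; first by case: idJ.
  exact: idealD.
by rewrite -mul_mpolyC; apply: idealM => //; apply/MJ/Mf.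
Qed.

Lemma idealX_var {K : fieldType} {n} {J : set {mpoly K[n]}} {i : 'I_n}
    (m : 'X_{1..n}) :
  ideal J -> J 'X_i -> (0 < m i)%N -> J 'X_[m].
Proof.
move=> idJ Ji mi.
have -> : m = (m - U_(i) + U_(i))%MM.
  rewrite submK //; apply/mnm_lepP => j; rewrite mnm1E.
  by case: eqP => // <-.
by rewrite mpolyXD; apply: idealM.
Qed.

Lemma ideal_gen_mon (K : fieldType) {n} (M : pred 'X_{1..n})
    (G : set {mpoly K[n]}) :
  upclosed M -> (G `<=` mon_ideal K M)%classic ->
  (forall m, M m -> ideal_gen G 'X_[m]) -> ideal_gen G = mon_ideal K M.
Proof.
move=> upM GM MG; apply/seteqP; split; last first.
  by apply: mon_ideal_sub => //; apply: ideal_gen_ideal.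
by apply: smallest_sub GM; apply: mon_ideal_ideal.
Qed.

(** The normal form of [f] modulo [mon_ideal K M]. *)
Definition mon_out {K : fieldType} {n} (M : pred 'X_{1..n}) (f : {mpoly K[n]}) :
  {mpoly K[n]} := \sum_(m <- msupp f | ~~ M m) f@_m *: 'X_[m].

Lemma mcoeff_mon_out {K : fieldType} {n} (M : pred 'X_{1..n})
    (f : {mpoly K[n]}) m :
  (mon_out M f)@_m = if M m then 0 else f@_m.
Proof.
rewrite raddf_sum /=.
under eq_bigr do rewrite mcoeffZ mcoeffX.
case: ifPn => Mm.
  rewrite big1 // => k Mk; case: eqP => [ek|_]; last by rewrite mulr0.
  by rewrite ek Mm in Mk.
have [mf|mf] := boolP (m \in msupp f).
  rewrite big_mkcond (bigD1_seq m) //= Mm eqxx mulr1 big1 ?addr0 //.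
  by move=> k /negPf->; rewrite mulr0 if_same.
rewrite (memN_msupp_eq0 mf) big1_seq // => k /andP[_ kf].
by case: eqP => [ek|]; rewrite ?mulr0 //; rewrite -ek kf in mf.
Qed.

Lemma msupp_mon_out {K : fieldType} {n} (M : pred 'X_{1..n})
    (f : {mpoly K[n]}) m :
  (m \in msupp (mon_out M f)) = ~~ M m && (m \in msupp f).
Proof. by rewrite !mcoeff_msupp mcoeff_mon_out; case: (M m); rewrite ?eqxx. Qed.

Lemma sub_mon_out {K : fieldType} {n} (M : pred 'X_{1..n})
    (f : {mpoly K[n]}) : mon_ideal K M (f - mon_out M f).
Proof.
move=> m; rewrite mcoeff_msupp mcoeffB mcoeff_mon_out.
by case: (M m) => //; rewrite subrr eqxx.
Qed.

Lemma mon_out_eq0 {K : fieldType} {n} (M : pred 'X_{1..n})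
    (f : {mpoly K[n]}) : mon_out M f = 0 -> mon_ideal K M f.
Proof. by move=> f0; have := sub_mon_out M f; rewrite f0 subr0. Qed.

Lemma colon_mon_out {K : fieldType} {n} (M : pred 'X_{1..n})
    (f h : {mpoly K[n]}) : upclosed M ->
  mon_ideal K M (h * mon_out M f) <-> mon_ideal K M (h * f).
Proof.
move=> /(mon_ideal_ideal K) idM.
have Md := idealM h _ idM (sub_mon_out M f); rewrite mulrBr in Md.
split=> H; first by have := idealD idM Md H; rewrite subrK.
by have := idealB idM H Md; rewrite subKr.
Qed.

(** Over a field leading terms do not cancel in a product, so the sum of the leading exponents lies
    in the support of [f * g]. *)
Lemma mlead_mul_mem {K : fieldType} {n} (M : pred 'X_{1..n})
    (f g : {mpoly K[n]}) : f != 0 -> g != 0 -> mon_ideal K M (f * g) ->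
  M (mlead f + mlead g)%MM.
Proof.
by move=> f0 g0; apply; rewrite -mleadM // mlead_supp // mulf_neq0.
Qed.

(** * The monomial primes P_A *)

Definition vars {n} (A : {set 'I_n}) : pred 'X_{1..n} :=
  [pred g : 'X_{1..n} | [exists i in A, 0 < g i]%N].

Lemma vars_upclosed {n} (A : {set 'I_n}) : upclosed (vars A).
Proof.
move=> g m /exists_inP[i iA mi]; apply/exists_inP; exists i => //.
by rewrite mnmDE ltn_addl.
Qed.

Lemma varsD {n} (A : {set 'I_n}) g m :
  vars A (g + m)%MM = vars A g || vars A m.
Proof.
apply/exists_inP/orP => [[i iA]|].
  rewrite mnmDE addn_gt0 => /orP[]; [left|right];
    by apply/exists_inP; exists i.
by case=> /exists_inP[i iA gi]; exists i => //; rewrite mnmDE addn_gt0 gi ?orbT.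
Qed.

Lemma monomial_primeE (K : fieldType) {n} (A : {set 'I_n}) :
  monomial_prime K A = mon_ideal K (vars A).
Proof.
apply: ideal_gen_mon; first exact: vars_upclosed.
  move=> _ [i iA ->]; apply/mon_idealX; apply/exists_inP; exists i => //.
  by rewrite mnm1E eqxx.
move=> m /exists_inP[i iA]; apply: (idealX_var _ (ideal_gen_ideal _)).
by apply: sub_gen_smallest; exists i.
Qed.

Lemma monomial_prime_inj (K : fieldType) {n} :
  injective (@monomial_prime K n).
Proof.
move=> A B eAB; apply/setP => i.
suff mem_vars (C : {set 'I_n}) : (i \in C) = `[< monomial_prime K C 'X_i >].
  by rewrite !mem_vars eAB.
rewrite monomial_primeE; apply/idP/asboolP => [iC|/mon_idealX].
  by apply/mon_idealX; apply/exists_inP; exists i; rewrite // mnm1E eqxx.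
by move=> /exists_inP[j jC]; rewrite mnm1E; case: eqP => [->|].
Qed.

(** Both factors may be replaced by their normal forms. If neither is zero, the leading monomial of
    the product is in P_A, hence so is that of one factor, a contradiction. *)
Lemma monomial_prime_prime (K : fieldType) {n} (A : {set 'I_n}) :
  prime_ideal (monomial_prime K A).
Proof.
have idA := mon_ideal_ideal K (vars_upclosed A).
rewrite monomial_primeE; split.
  split; first by apply: mem_set; case: idA.
    apply/negP => /set_mem; rewrite -mpolyX0 => /mon_idealX/exists_inP[i _].
    by rewrite mnm0E.
  move=> a u v /set_mem Au /set_mem Av; apply: mem_set.
  by case: idA => _; apply.
move=> u v /set_mem.
move=> /(colon_mon_out _ _ _ (vars_upclosed A)); rewrite mulrC.
move=> /(colon_mon_out _ _ _ (vars_upclosed A)) Auv.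
have [u0|u0] := eqVneq (mon_out (vars A) u) 0.
  by apply/orP; left; apply/mem_set/mon_out_eq0.
have [v0|v0] := eqVneq (mon_out (vars A) v) 0.
  by apply/orP; right; apply/mem_set/mon_out_eq0.
have := mlead_mul_mem _ _ _ v0 u0 Auv; rewrite varsD.
have := mlead_supp u0; have := mlead_supp v0.
by rewrite !msupp_mon_out => /andP[/negPf-> _] /andP[/negPf->].
Qed.

(** * Associated primes of monomial ideals *)

Lemma prime_ideal_monomial {K : fieldType} {n} {P : set {mpoly K[n]}} g :
  prime_ideal P -> P 'X_[g] <-> vars [set i | `[< P 'X_i >]]%SET g.
Proof.
move=> pP; have idP := prime_ideal_ideal pP; split=> [|/exists_inP[i]].
  rewrite mpolyXE_id.
  suff H (s : seq 'I_n) : P (\prod_(i <- s) 'X_i ^+ g i) ->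
    vars [set i | `[< P 'X_i >]]%SET g by apply: H.
  elim: s => [|i s IHs]; first by rewrite big_nil => /(prime_ideal1 pP).
  rewrite big_cons => /(prime_idealM _ _ pP)[|//].
  case gi: (g i) => [|k]; first by rewrite expr0 => /(prime_ideal1 pP).
  move=> Pi; apply/exists_inP; exists i; rewrite ?gi // inE; apply/asboolP.
  move: Pi {gi}; elim: k => [|k IHk]; first by rewrite expr1.
  by rewrite exprS => /(prime_idealM _ _ pP)[].
by rewrite inE => /asboolP Pi gi; apply: (idealX_var _ idP Pi).
Qed.

(* Take f of minimal support with annihilator P modulo the monomial ideal: if a
   monomial g outside P sent a term of f into the ideal, then g f, with its
   terms in the ideal removed, would be a smaller witness. Hence every term of
   f has the same monomial multipliers as f itself. *)
Lemma Ass_mon_witness (K : fieldType) {n} (M : pred 'X_{1..n})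
    (P : set {mpoly K[n]}) (f : {mpoly K[n]}) :
  upclosed M -> prime_ideal P -> P = [set h | mon_ideal K M (h * f)]%classic ->
  exists A u, P = monomial_prime K A /\ forall g, M (g + u)%MM = vars A g.
Proof.
move=> upM pP; have idM := mon_ideal_ideal K upM.
have idP := prime_ideal_ideal pP.
have [s] := ubnP (size (msupp f)); elim: s f => // s IHs f ltfs Pf.
have PE h : P h <-> mon_ideal K M (h * f) by rewrite Pf.
have [[g [m [mf nPg Mgm]]]|min_f] := pselect (exists g m,
    [/\ m \in msupp f, ~ P 'X_[g] & M (g + m)%MM]).
  apply: (IHs (mon_out M (f * 'X_[g]))).
    have sub : {subset msupp (mon_out M (f * 'X_[g])) <=
        [seq (g + k)%MM | k <- rem m (msupp f)]}.
      move=> k; rewrite msupp_mon_out (perm_mem (msuppMX f g)).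
      move=> /andP[nMk /mapP[l lf ek]]; apply/mapP; exists l => //.
      rewrite mem_rem_uniq // inE lf andbT; apply: contraNneq nMk => lm.
      by rewrite ek lm.
    have := uniq_leq_size (msupp_uniq _) sub; rewrite [leqRHS]size_map size_rem //.
    by case: (msupp f) mf ltfs => //= ? ? _; lia.
  (* As P is prime and does not contain x^g, multiplying [f] by x^g does not change the
     annihilator. *)
  rewrite predeqE => h; rewrite /= colon_mon_out // mulrCA mulrC -PE.
  by split=> [Ph|/(prime_idealM _ _ pP)[]//]; rewrite mulrC; apply: idealM.
have nzf : f != 0.
  apply/eqP => f0; apply: (prime_ideal1 pP); apply/PE.
  by rewrite f0 mulr0; case: idM.
have PX g m : m \in msupp f -> P 'X_[g] <-> M (g + m)%MM.
  move=> mf; split=> [/PE|Mgm]; last first.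
    by apply: contrapT => nPg; apply: min_f; exists g, m.
  apply; rewrite mulrC (perm_mem (msuppMX f g)).
  by apply/mapP; exists m.
exists [set i | `[< P 'X_i >]]%SET, (mlead f); split; last first.
  move=> g; apply/Bool.eq_iff_eq_true.
  apply: iff_trans (prime_ideal_monomial g pP).
  exact: iff_sym (PX g _ (mlead_supp nzf)).
rewrite monomial_primeE; set A := (X in vars X).
have AP : (mon_ideal K (vars A) `<=` P)%classic.
  by apply: mon_ideal_sub => // m /(prime_ideal_monomial _ pP).
(* If the normal form of [h] modulo P_A were nonzero, its leading monomial would multiply that of
   [f] into the ideal, hence lie in P and so in P_A. *)
apply/seteqP; split=> // h Ph; apply: mon_out_eq0; apply/eqP.
apply: contraT => h0.
have Ph' : P (mon_out (vars A) h).
  have -> : mon_out (vars A) h = h - (h - mon_out (vars A) h) by rewrite subKr.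
  by apply: idealB => //; apply/AP/sub_mon_out.
move: Ph' => /PE /(mlead_mul_mem _ _ _ h0 nzf)/(PX _ _ (mlead_supp nzf)).
move=> /(prime_ideal_monomial _ pP); have := mlead_supp h0.
by rewrite msupp_mon_out => /andP[/negPf->].
Qed.

Lemma Ass_mon_ideal (K : fieldType) {n} (M : pred 'X_{1..n})
    (P : set {mpoly K[n]}) : upclosed M ->
  Ass (mon_ideal K M) P <->
  exists A u, P = monomial_prime K A /\ forall g, M (g + u)%MM = vars A g.
Proof.
move=> upM; split=> [[pP [f Pf]]|[A [u [-> Au]]]].
  exact: Ass_mon_witness Pf.
split; first exact: monomial_prime_prime.
exists 'X_[u]; rewrite monomial_primeE predeqE => h; split=> [Ah m|Mh m mh].
  rewrite (perm_mem (msuppMX h u)) => /mapP[g /Ah gA ->].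
  by rewrite addmC Au.
rewrite -Au; apply: Mh; rewrite (perm_mem (msuppMX h u)).
by apply/mapP; exists m => //; rewrite addmC.
Qed.

(** * Powers of ideals of Veronese type *)

Lemma sum_between {n} (l h : 'I_n -> nat) s :
  (forall i, l i <= h i)%N -> (\sum_i l i <= s <= \sum_i h i)%N ->
  exists u : 'X_{1..n},
    (forall i, l i <= u i <= h i)%N /\ (\sum_i u i)%N = s.
Proof.
move=> lh /andP[/subnKC <-]; elim: (s - _)%N => [|t IHt] ht.
  exists [multinom l i | i < n]; split=> [i|]; first by rewrite mnmE leqnn lh.
  by rewrite addn0; apply: eq_bigr => i _; rewrite mnmE.
have [|u [bu su]] := IHt; first by apply: leq_trans ht; rewrite leq_add2l.
(* While the sum is below that of [h], some entry can be raised by one. *)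
have [i ui] : exists i, (u i < h i)%N.
  apply: contrapT => no; move: ht; rewrite addnS -su ltnNge => /negP; apply.
  apply: leq_sum => i _; rewrite leqNgt; apply/negP => ui; apply: no.
  by exists i.
exists (u + U_(i))%MM; split=> [j|].
  have := bu j; rewrite mnmDE mnm1E; case: eqP => [<-|_] /=; last by rewrite addn0.
  by lia.
by rewrite -mdegE mdegD mdeg1 mdegE su addn1 addnS.
Qed.

Lemma sum_mem_card {n} (A : {set 'I_n}) : (\sum_i (i \in A))%N = #|A|.
Proof. by rewrite -sum1_card [RHS]big_mkcond; apply: eq_bigr => i _; case: ifP. Qed.

(* The exponents of the monomials of I^k: w is divisible by some v <= k a of
   degree k d iff sum_i min (w i) (k a_i) >= k d. *)
Definition vthr {n} d (a : 'I_n -> nat) k : pred 'X_{1..n} :=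
  [pred w : 'X_{1..n} | (k * d <= \sum_i minn (w i) (k * a i))%N].

Lemma vthr_upclosed {n} d (a : 'I_n -> nat) k : upclosed (vthr d a k).
Proof.
move=> g m /= /leq_trans; apply; apply: leq_sum => i _.
by rewrite mnmDE; lia.
Qed.

(** In each coordinate, min (x, a) + min (y, k a) <= min (x + y, (k + 1) a). *)
Lemma vthrD {n} d (a : 'I_n -> nat) k u v :
  vthr d a 1 u -> vthr d a k v -> vthr d a k.+1 (u + v)%MM.
Proof.
rewrite /vthr /= mul1n mulSn => ud vd; apply: leq_trans (leq_add ud vd) _.
rewrite -big_split; apply: leq_sum => i _ /=.
by rewrite mnmDE mulSn; lia.
Qed.

(* A vector w' <= w of degree (k + 1) d with w' <= (k + 1) a splits as u + v with
   u <= a and v <= k a, since w' / (k + 1) lies between max 0 (w' - k a) and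
   min a w'. *)
Lemma vthrS {n} d (a : 'I_n -> nat) k w :
  vthr d a k.+1 w ->
  exists u v, [/\ vthr d a 1 u, vthr d a k v & w = (u + v)%MM].
Proof.
move=> /= hw.
have [||w' [bw' sw']] := sum_between (fun=> 0%N)
  (fun i => minn (w i) (k.+1 * a i)) (k.+1 * d) => //.
  by rewrite big1.
have [||u [bu su]] := sum_between (fun i => w' i - k * a i)%N
  (fun i => minn (a i) (w' i)) d.
- by move=> i; have := bw' i; rewrite mulSn; lia.
- rewrite -[X in (X && _)%N](@leq_pmul2l k.+1) // -[X in (_ && X)%N](@leq_pmul2l k.+1) //.
  rewrite -sw' !big_distrr /=; apply/andP; split; apply: leq_sum => i _;
    by have := bw' i; nia.
exists u, (w - u)%MM; split=> /=.
- rewrite /vthr /= mul1n -su; apply: leq_sum => i _; have := bu i; lia.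
- rewrite /vthr /= -(leq_add2r d) addnC -mulSn -sw' -su -big_split /=.
  apply: leq_sum => i _; rewrite mnmBE; have := bu i; have := bw' i; lia.
apply/mnmP => i; rewrite mnmDE mnmBE; have := bu i; have := bw' i; lia.
Qed.

Lemma veroneseE (K : fieldType) {n} d (a : 'I_n -> nat) :
  veronese K d a = mon_ideal K (vthr d a 1).
Proof.
apply: ideal_gen_mon; first exact: vthr_upclosed.
  move=> _ [u [du ua ->]]; apply/mon_idealX; rewrite /vthr /= mul1n -du mdegE.
  by apply: leq_sum => i _; have := ua i; lia.
move=> w /= dw.
(* Lowering [w] to degree exactly [d] below [a] gives a generator dividing x^w. *)
have [||u [bu su]] := sum_between (fun=> 0%N) (fun i => minn (w i) (1 * a i)) d => //.
  by rewrite big1 //= -{1}[d]mul1n.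
have -> : w = (w - u + u)%MM.
  by rewrite submK //; apply/mnm_lepP => i; have := bu i; lia.
rewrite mpolyXD; apply: (idealM _ _ (ideal_gen_ideal _)).
apply: sub_gen_smallest; exists u; split=> //; first by rewrite mdegE.
by move=> i; have := bu i; lia.
Qed.

Lemma ideal_pow_veroneseE (K : fieldType) {n} d (a : 'I_n -> nat) k :
  ideal_pow (veronese K d a) k = mon_ideal K (vthr d a k).
Proof.
elim: k => [|k IHk]; first by apply/seteqP; split=> // f _ m _ /=.
rewrite /ideal_pow iterS -/(ideal_pow _ _) {}IHk veroneseE.
apply: ideal_gen_mon; first exact: vthr_upclosed.
  move=> _ [f [g [If Ig ->]]] m /msuppM_le/allpairsP[[u v] /= [uf vg ->]].
  by apply: vthrD; [apply: If | apply: Ig].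
move=> w /vthrS[u [v [uI vI ->]]]; apply: sub_gen_smallest.
by exists 'X_[u], 'X_[v]; split; rewrite ?mpolyXD //; apply/mon_idealX.
Qed.

(** * When P_A is a colon ideal of I^k by a monomial *)

Lemma vthr_colon_vars {n} d (a : 'I_n -> nat) k (A : {set 'I_n}) u :
  (d < \sum_i a i)%N -> (0 < k)%N ->
  (forall g, vthr d a k (g + u)%MM = vars A g) ->
  (\sum_(i in ~: A) a i < d)%N /\ (#|A| <= (k * (\sum_i a i - d)).+1)%N.
Proof.
move=> hd k0 Au.
have outA : (\sum_(i in ~: A) a i < d)%N.
  (* The monomial with exponent k a outside A and 0 on A is not in P_A, so its product with x^u is
     not in I^k. *)
  have := Au [multinom if i \in A then 0%N else (k * a i)%N | i < n].
  have -> : vars A [multinom if i \in A then 0%N else (k * a i)%N | i < n] = false.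
    by apply/exists_inP => -[i iA]; rewrite mnmE iA.
  move=> /negbT; rewrite /= -ltnNge => lt_kd.
  rewrite -(@ltn_pmul2l k) //; apply: leq_ltn_trans lt_kd.
  rewrite big_distrr big_mkcond; apply: leq_sum => i _ /=.
  by rewrite mnmDE mnmE finset.in_setC; case: (i \in A) => //=; lia.
split=> //.
have ltu : (\sum_i minn (u i) (k * a i) < k * d)%N.
  rewrite ltnNge; apply/negP => le; have := Au 0%MM; rewrite add0m /vthr /= le.
  by move=> /esym/exists_inP[i _]; rewrite mnm0E.
have leu i : i \in A -> (k * d <= \sum_j minn ((U_(i) + u)%MM j) (k * a j))%N.
  move=> iA; have := Au U_(i)%MM.
  have -> : vars A U_(i)%MM by apply/exists_inP; exists i; rewrite // mnm1E eqxx.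
  by [].
have [i iA] : exists i, i \in A.
  apply/finset.set0Pn/eqP => A0; move: outA; rewrite A0 ltnNge => /negP; apply.
  rewrite finset.setC0; under eq_bigl do rewrite finset.in_setT.
  exact: ltnW.
(* One variable raises the truncated degree by at most one; with [ltu], that degree is exactly k d -
   1. *)
have le1 : (k * d <= (\sum_j minn (u j) (k * a j)).+1)%N.
  apply: leq_trans (leu i iA) _; rewrite -add1n -(mdeg1 i) mdegE -big_split /=.
  by apply: leq_sum => j _; rewrite mnmDE; lia.
(* If u_j had reached k a_j, multiplying by x_j would not change the truncation. *)
have ltA j : j \in A -> (u j < k * a j)%N.
  move=> jA; rewrite ltnNge; apply/negP => kau.
  have := leq_trans ltu (leu j jA); rewrite ltnNge => /negP; apply.
  apply: leq_sum => l _; rewrite mnmDE mnm1E; case: eqP => [<-|_] //=.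
  by lia.
(* Each j in A leaves a gap of at least one below k a_j; with [le1] this bounds |A|. *)
have : (\sum_j minn (u j) (k * a j) + #|A| <= k * \sum_j a j)%N.
  rewrite -sum_mem_card -big_split big_distrr; apply: leq_sum => j _ /=.
  by have [/ltA|] := boolP (j \in A); lia.
by rewrite mulnBr; lia.
Qed.

Lemma exists_vthr_colon_vars {n} d (a : 'I_n -> nat) k (A : {set 'I_n}) :
  (d < \sum_i a i)%N -> (0 < k)%N -> (forall i, 1 <= a i)%N ->
  (\sum_(i in ~: A) a i < d)%N -> (#|A| <= (k * (\sum_i a i - d)).+1)%N ->
  exists u, forall g, vthr d a k (g + u)%MM = vars A g.
Proof.
move=> hd k0 ha outA leA.
have kd0 : (0 < k * d)%N by rewrite muln_gt0 k0; case: (d) outA.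
have ka0 i : (0 < k * a i)%N by rewrite muln_gt0 k0 ha.
(* The witness has degree k d - 1, equals k a outside A and stays below k a on A. The two sum bounds
   come from [outA] and [leA]. *)
have [||u [bu su]] := sum_between
    (fun i => if i \in A then 0 else k * a i)%N
    (fun i => k * a i - (i \in A))%N (k * d).-1.
- by move=> i; case: (i \in A) => /=; lia.
- apply/andP; split.
    rewrite -ltnS (prednK kd0) (eq_bigr (fun i => k * if i \in ~: A then a i else 0)%N).
      by rewrite -big_distrr -big_mkcond ltn_pmul2l.
    by move=> i _; rewrite finset.in_setC; case: (i \in A) => /=; lia.
  rewrite -(leq_add2r #|A|) -{2}sum_mem_card -big_split /=.
  rewrite (eq_bigr (fun i => k * a i)%N) => [|i _].
    have : (k * d < k * \sum_i a i)%N by rewrite ltn_pmul2l.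
    by move: leA; rewrite mulnBr -big_distrr /=; lia.
  by have := ka0 i; case: (i \in A) => /=; lia.
exists u => g; apply/idP/exists_inP => [le_kd|[i iA gi]] /=.
  (* If [g] vanishes on A, it raises only coordinates already at k a. *)
  apply: contrapT => noA.
  suff : (\sum_i minn ((g + u)%MM i) (k * a i) <= (k * d).-1)%N.
    by move: le_kd; rewrite /vthr /=; lia.
  rewrite -su; apply: leq_sum => i _; rewrite mnmDE; have := bu i.
  have [iA _|_] := boolP (i \in A); last by lia.
  have [|gi] := posnP (g i); first by lia.
  by case: noA; exists i.
rewrite /vthr /= -(prednK kd0) -su -add1n -(mdeg1 i) mdegE -big_split /=.
apply: leq_sum => j _; rewrite mnmDE mnm1E; have := bu j; have := ka0 j.
by case: eqP => [<-|_]; rewrite ?iA; lia.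
Qed.

(** * Associated primes of the powers and their stability *)

Lemma Ass_pow_veronese (K : fieldType) {n} d (a : 'I_n -> nat) k
    (P : set {mpoly K[n]}) :
  (d < \sum_i a i)%N -> (forall i, 1 <= a i)%N -> (0 < k)%N ->
  Ass (ideal_pow (veronese K d a) k) P <->
  exists A : {set 'I_n}, [/\ P = monomial_prime K A,
    (\sum_(i in ~: A) a i < d)%N & (#|A| <= (k * (\sum_i a i - d)).+1)%N].
Proof.
move=> hd ha k0; rewrite ideal_pow_veroneseE.
rewrite (Ass_mon_ideal _ _ _ (vthr_upclosed d a k)).
split=> [[A [u [-> Au]]]|[A [-> outA leA]]]; exists A.
  by have [outA leA] := vthr_colon_vars _ _ _ _ _ hd k0 Au; split.
by have [u Au] := exists_vthr_colon_vars _ _ _ _ hd k0 ha outA leA; exists u.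
Qed.

Lemma Ass_pow_veronese_monomial (K : fieldType) {n} d (a : 'I_n -> nat) k
    (A : {set 'I_n}) :
  (d < \sum_i a i)%N -> (forall i, 1 <= a i)%N -> (0 < k)%N ->
  Ass (ideal_pow (veronese K d a) k) (monomial_prime K A) <->
  (\sum_(i in ~: A) a i < d)%N /\ (#|A| <= (k * (\sum_i a i - d)).+1)%N.
Proof.
move=> hd ha k0; rewrite Ass_pow_veronese //.
split=> [[B [/monomial_prime_inj<-]]|[]] //.
by exists A.
Qed.

Lemma Ass_stable_from_veronese (K : fieldType) {n} d (a : 'I_n -> nat) k :
  (0 < d < \sum_i a i)%N -> (forall i, 1 <= a i)%N ->
  Ass_stable_from (veronese K d a) k <->
  (0 < k)%N /\ (n.-1 <= k * (\sum_i a i - d))%N.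
Proof.
move=> /andP[d0 hd] ha; have D0 : (0 < \sum_i a i - d)%N by rewrite subn_gt0.
split=> [[k0 stk]|[k0 lek]]; split=> //.
  (* The power k + n is large enough for the prime of all variables to occur, since sum a - d >= 1;
     stability carries it back to k. *)
  have eqk := stk (k + n)%N (leq_addr _ _).
  have : Ass (ideal_pow (veronese K d a) k) (monomial_prime K [set: 'I_n]).
    rewrite -eqk Ass_pow_veronese_monomial ?addn_gt0 ?k0 //.
    rewrite finset.setCT big_set0 cardsT card_ord; split=> //.
    by nia.
  by rewrite Ass_pow_veronese_monomial // cardsT card_ord => -[_]; lia.
move=> j kj; have j0 := leq_trans k0 kj.
rewrite predeqE => P; rewrite !Ass_pow_veronese //.
(* From k on, every A satisfies the cardinality bound, so only the condition on the complement,
   independent of the power, decides. *)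
have cardA (A : {set 'I_n}) i : (k <= i)%N ->
    (#|A| <= (i * (\sum_i a i - d)).+1)%N.
  by move=> ki; have := max_card A; rewrite card_ord; nia.
by split=> -[A [-> outA _]]; exists A; split=> //; apply: cardA.
Qed.

(** * Least integers and ceilings *)

Lemma leastE (E : set nat) m :
  E m -> (forall j, E j -> m <= j)%N -> least E = m.
Proof.
move=> Em min_m; apply: xget_unique => // k [Ek min_k].
by apply/eqP; rewrite eqn_leq min_m // min_k.
Qed.

(** The least m satisfies (m - 1) D < q <= m D, which characterizes the ceiling of q / D; and k = q
    is admissible. *)
Lemma least_mul_ge q D : (0 < q)%N -> (0 < D)%N ->
  (least [set k | (0 < k)%N /\ (q <= k * D)%N]%classic)%:Z =
    Num.ceil (q%:R / D%:R : rat) /\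
  (least [set k | (0 < k)%N /\ (q <= k * D)%N]%classic <= q)%N.
Proof.
move=> q0 D0.
have ex : exists k, (0 < k)%N && (q <= k * D)%N.
  by exists q; rewrite q0 leq_pmulr.
case: (ex_minnP ex) => m /andP[m0 qm] min_m.
rewrite (leastE _ m) //; last by move=> j [j0 qj]; apply: min_m; rewrite j0.
split; last by apply: min_m; rewrite q0 leq_pmulr.
apply/esym/ceil_def.
have D0' : 0 < D%:R :> rat by rewrite ltr0n.
rewrite ltr_pdivlMr // ler_pdivrMr // -(prednK m0).
have -> : (m.-1.+1%:Z - 1 = m.-1%:Z) by lia.
rewrite (prednK m0) !pmulrn -!natrM ltr_nat ler_nat qm andbT ltnNge.
apply/negP => qm1; have /min_m : (0 < m.-1)%N && (q <= m.-1 * D)%N.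
  by rewrite qm1 andbT; case: (m.-1) qm1; rewrite // mul0n leqNgt q0.
by lia.
Qed.

(** Every positive k qualifies, so the minimum is 1 and not the ceiling of 0 / D; this serves |A| =
    1 and n = 1. *)
Lemma least_mul_ge0 D :
  least [set k | (0 < k)%N /\ (0 <= k * D)%N]%classic = 1%N.
Proof. by apply: leastE => [|j []]. Qed.

(* The formulas with the ceiling are stated for |A| > 1 and n > 1: for |A| = 1
   (resp. n = 1) they give 0, whereas the index of stability, being a positive
   integer, is 1. These cases are stated separately. *)
Theorem corollary4p6 (K : fieldType) (n d : nat) (a : 'I_n -> nat)
    (hd : (d < \sum_(i < n) a i)%N) (hd1 : (1 < d)%N)
    (ha : forall i : 'I_n, (1 <= a i)%N) :
  (forall A : {set 'I_n},
     Ass_infty (veronese K d a) (monomial_prime K A) ->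
     ((1 < #|A|)%N ->
        (prime_astab (veronese K d a) (monomial_prime K A))%:Z =
        Num.ceil ((#|A|%:R - 1) / ((\sum_(i < n) a i)%N%:R - d%:R) : rat)) /\
     (#|A| = 1%N ->
        prime_astab (veronese K d a) (monomial_prime K A) = 1%N)) /\
  ((1 < n)%N ->
     (astab (veronese K d a))%:Z =
     Num.ceil ((n%:R - 1) / ((\sum_(i < n) a i)%N%:R - d%:R) : rat) /\
     (astab (veronese K d a) <= n - 1)%N) /\
  (n = 1%N -> astab (veronese K d a) = 1%N).
Proof.
have D0 : (0 < \sum_i a i - d)%N by rewrite subn_gt0.
have ceilE q : (1 < q)%N ->
    (q%:R - 1) / ((\sum_(i < n) a i)%N%:R - d%:R) =
    (q.-1)%:R / (\sum_i a i - d)%N%:R :> rat.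
  by move=> q1; rewrite -subn1 !natrB // ltnW.
have astabE : astab (veronese K d a) =
    least [set k | (0 < k)%N /\ (n.-1 <= k * (\sum_i a i - d))%N]%classic.
  congr least; rewrite predeqE => k /=.
  by apply: Ass_stable_from_veronese => //; rewrite hd ltnW.
split=> [A [k1 [k10 _]]|].
  (* The condition on the complement of A, read off at one power, holds for all; what remains is to
     minimize k under |A| - 1 <= k (sum a - d). *)
  move=> /(Ass_pow_veronese_monomial _ _ _ _ _ hd ha k10)[outA _].
  have -> : prime_astab (veronese K d a) (monomial_prime K A) =
      least [set k | (0 < k)%N /\ (#|A|.-1 <= k * (\sum_i a i - d))%N]%classic.
    congr least; rewrite predeqE => k /=.
    split=> -[k0 H]; split=> //.
      by move: H => /(Ass_pow_veronese_monomial _ _ _ _ _ hd ha k0)[_]; case: #|A|.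
    apply/(Ass_pow_veronese_monomial _ _ _ _ _ hd ha k0); split=> //.
    by move: H; case: #|A|.
  split=> [A1|->]; last exact: least_mul_ge0.
  by rewrite ceilE //; apply: (least_mul_ge _ _ _ D0).1; lia.
rewrite astabE; split=> [n1|n1]; last first.
  have -> : n.-1 = 0%N by rewrite n1.
  exact: least_mul_ge0.
by rewrite ceilE // subn1; apply: least_mul_ge => //; lia.
Qed.
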